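(* Let $C(x_1,\dots,x_k)$ be a continuously differentiable copula. Let $\mathbf{M}^i=(M^{i,u}:u\in[0,\infty])$, $1\le i\le k$, be i$M_Z$ families (each for some Azéma supermartingale) that are differentiable at a point $T\in[0,\infty]$ with respect to one and the same increasing process $A$. Let $\tau_i$, $1\le i\le k$, be a family of random times such that their conditional law given $\mathcal{F}_T$ has the (multi-dimensional) distribution function $(u_1,\dots,u_k)\mapsto C(M^{1,u_1}_T,\dots,M^{k,u_k}_T)$ on $0\le u_1,\dots,u_k\le T$. Then the order statistics $\sigma_1\le\dots\le\sigma_k$ of $\tau_1,\dots,\tau_k$ satisfy the differentiability condition for their i$M$ families at every $t\in[0,T]$ with respect to $A$; that is, for each $i$ the i$M$ family associated with $(\mathbb{Q},\mathbb{F},\sigma_i)$ is differentiable at every $t\in[0,T]$ with respect to $A$.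
   Context: Setting. $(\Omega,\mathcal{A},\mathbb{Q})$ is a probability space with a right-continuous filtration $\mathbb{F}=(\mathcal{F}_t)_{t\in\mathbb{R}_+}$, $\mathcal{F}_\infty=\bigvee_t\mathcal{F}_t\subset\mathcal{A}$, $\mathbb{F}$ containing the $(\mathbb{Q},\mathcal{F}_\infty)$-null sets. A random time is a $[0,\infty]$-valued random variable. i$M$ family. An i$M(\mathbb{Q},\mathbb{F})$ family is a family of processes $(M^u:u\in[0,\infty])$ such that: (1) for every $u$, $M^u$ is a $[0,1]$-valued $(\mathbb{Q},\mathbb{F})$-martingale on $[u,\infty]$; (2) for every $t\in[0,\infty]$, $u\in[0,t]\mapsto M^u_t$ is right-continuous and non-decreasing; (3) $M^\infty_\infty=1$. An Azéma supermartingale is a $(\mathbb{Q},\mathbb{F})$-supermartingale $Z$ with $0\le Z\le1$; an i$M_Z$ family is an i$M$ family with $M^u_u=1-Z_u$ and $M^u_t\le1-Z_t$ for $0\le u\le t<\infty$. The i$M$ family associated with $(\mathbb{Q},\mathbb{F},\sigma)$ for a random time $\sigma$ is the i$M$ family with $M^u_t=\mathbb{Q}[\sigma\le u\mid\mathcal{F}_t]$. Differentiability. For a non-negative $\mathbb{F}$-adapted increasing càdlàg process $A$, an i$M$ family is differentiable at $t\in[0,\infty]$ with respect to $A$ if there is a non-negative $\mathcal{F}_t\otimes\mathcal{B}[0,\infty]$-measurable function $\mathsf{p}_t(\omega,v)$ such that for almost all $\omega$, $M^u_t=\int_{[0,u]}\mathsf{p}_t(v)\,dA_v$ for all $u\in[0,t]$.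 Order statistics. $\sigma_i$ is the $i$-th smallest value among $\tau_1,\dots,\tau_k$, i.e. $\{\sigma_i\le t\}=\bigcup_{I\subset\{1,\dots,k\},\,\sharp I=i}\{\tau_j\le t\ \forall j\in I\}$. A copula is a distribution function on $[0,1]^k$ with uniform marginals.
   Formalization: For T<∞ the conditional law of the τ's is also prescribed when some coordinates are left unconstrained (the corresponding arguments of C being 1), since the distribution function on [0,T]^k alone does not determine the order statistics' laws and the claim then fails. *)

(* Defs.v *)
From HB Require Import structures.
From mathcomp Require Import all_boot all_order all_algebra.
From mathcomp Require Import all_classical all_reals all_analysis.
From mathcomp Require Import measurable_realfun.

Set Implicit Arguments.
Unset Strict Implicit.
Unset Printing Implicit Defensive.
Import Order.TTheory GRing.Theory Num.Theory.
Import numFieldNormedType.Exports.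

Local Open Scope classical_set_scope.
Local Open Scope ring_scope.

(* Time runs over [0, +oo], encoded as the nonnegative elements of [\bar R];
   what processes and filtrations are at negative times is irrelevant. *)

Section processes.
Context (R : realType) (d : measure_display) (Omega : measurableType d).
Implicit Types (P : probability Omega R) (F : \bar R -> set (set Omega)).

Record filtration P F : Prop := {
  filtration_sigma : forall t, (0 <= t)%E -> sigma_algebra setT (F t) ;
  filtration_sub : forall t, (0 <= t)%E -> F t `<=` measurable ;
  filtration_mono : forall s t, (0 <= s)%E -> (s <= t)%E -> F s `<=` F t ;
  filtration_right_continuous : forall t : R, 0 <= t ->
    F t%:E = \bigcap_(s in [set s : R | t < s]) F s%:E ;
  filtration_infty : F +oo%E = <<s \bigcup_(t in [set t : R | 0 <= t]) F t%:E >> ;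
  filtration_null : forall N, F +oo%E N -> P N = 0%E -> F 0%E N }.

(* For a sigma-algebra [G], [g_sigma_algebraType G] is [Omega] equipped with
   [G] itself. *)
Definition measurable_wrt (G : set (set Omega)) (X : Omega -> R) : Prop :=
  measurable_fun [set: g_sigma_algebraType G] (X : g_sigma_algebraType G -> R).

(* [X] is a version of E[Y | G]. *)
Definition is_condexp P (G : set (set Omega)) (Y X : Omega -> R) : Prop :=
  [/\ measurable_wrt G X,
      P.-integrable setT (EFin \o X) &
      forall B, G B ->
        (\int[P]_(w in B) (X w)%:E = \int[P]_(w in B) (Y w)%:E)%E].

(* [X] is a version of P[E | G]. *)
Definition is_condprob P (G : set (set Omega)) (E : set Omega)
  (X : Omega -> R) : Prop := is_condexp P G \1_E X.

Definition martingale_from P F (u : \bar R) (X : \bar R -> Omega -> R) : Prop :=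
  [/\ forall t, (u <= t)%E -> measurable_wrt (F t) (X t),
      forall t, (u <= t)%E -> P.-integrable setT (EFin \o X t) &
      forall s t, (u <= s)%E -> (s <= t)%E -> is_condexp P (F s) (X t) (X s)].

Definition supermartingale P F (X : R -> Omega -> R) : Prop :=
  [/\ forall t, 0 <= t -> measurable_wrt (F t%:E) (X t),
      forall t, 0 <= t -> P.-integrable setT (EFin \o X t) &
      forall s t, 0 <= s -> s <= t ->
        exists2 Y, is_condexp P (F s%:E) (X t) Y &
                   {ae P, forall w, Y w <= X s w}].

Definition azema_supermartingale P F (Z : R -> Omega -> R) : Prop :=
  supermartingale P F Z /\ forall t w, 0 <= t -> 0 <= Z t w <= 1.

(* [M u t w] is M^u_t(w); only the values for 0 <= u <= t matter. *)
Record iM_family P F (M : \bar R -> \bar R -> Omega -> R) : Prop := {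
  iM_martingale : forall u, (0 <= u)%E -> martingale_from P F u (M u) ;
  iM_itv01 : forall u t w, (0 <= u)%E -> (u <= t)%E -> 0 <= M u t w <= 1 ;
  iM_nondecreasing : forall t w u v, (0 <= u)%E -> (u <= v)%E -> (v <= t)%E ->
    M u t w <= M v t w ;
  iM_right_continuous : forall t w (u : R), 0 <= u -> (u%:E < t)%E ->
    M v%:E t w @[v --> u^'+] --> M u%:E t w ;
  iM_infty : {ae P, forall w, M +oo%E +oo%E w = 1} }.

Record iM_Z_family P F (Z : R -> Omega -> R)
    (M : \bar R -> \bar R -> Omega -> R) : Prop := {
  iM_Z_iM : iM_family P F M ;
  iM_Z_diag : forall u : R, 0 <= u ->
    {ae P, forall w, M u%:E u%:E w = 1 - Z u w} ;
  iM_Z_le : forall u t : R, 0 <= u -> u <= t ->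
    {ae P, forall w, M u%:E t%:E w <= 1 - Z t w} }.

Definition random_time (sigma : Omega -> \bar R) : Prop :=
  measurable_fun setT sigma /\ forall w, (0 <= sigma w)%E.

Definition associated_iM_family P F (sigma : Omega -> \bar R)
    (N : \bar R -> \bar R -> Omega -> R) : Prop :=
  iM_family P F N /\
  forall u t, (0 <= u)%E -> (u <= t)%E ->
    is_condprob P (F t) [set w | (sigma w <= u)%E] (N u t).

(* A nonnegative increasing right-continuous real-valued process on [0, +oo[:
   every path is extended by 0 to negative times, so that its Stieltjes measure
   has the atom A_0 at 0.  Left limits come from monotonicity.  The process may
   in addition charge +oo: [ip_jump] is A_oo - A_{oo-}, and is 0 for a process
   indexed by [0, +oo[ only. *)
Structure increasing_process := IncreasingProcess {
  ip_path : Omega -> cumulative R R ;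
  ip_path_lt0 : forall w r, r < 0 -> ip_path w r = 0 ;
  ip_jump : Omega -> {nonneg R} }.

Definition ip_adapted F (A : increasing_process) : Prop :=
  (forall t, 0 <= t -> measurable_wrt (F t%:E) (fun w => ip_path A w t)) /\
  measurable_wrt (F +oo%E) (fun w => (ip_jump A w)%:num).

(* The random measure dA on [0, +oo], as a measure on [\bar R]. *)
Definition ip_measure (A : increasing_process) (w : Omega) :
  {measure set (\bar R) -> \bar R}.
Proof.
refine (measure_add
  (pushforward (lebesgue_stieltjes_measure (ip_path A w)) (@EFin R))
  (mscale (ip_jump A w) (dirac (+oo%E : \bar R)))).
exact: EFin_measurable.
Defined.

Definition differentiable_iM P F (A : increasing_process)
    (M : \bar R -> \bar R -> Omega -> R) (t : \bar R) : Prop :=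
  exists p : g_sigma_algebraType (F t) * \bar R -> R,
    [/\ measurable_fun setT p,
        forall x, 0 <= p x &
        {ae P, forall w, forall u, (0 <= u)%E -> (u <= t)%E ->
          ((M u t w)%:E =
             \int[ip_measure A w]_(v in `[0%E, u]) (p (w, v))%:E)%E}].

End processes.

Section copulas.
Context (R : realType) (k : nat).

Definition unit_cube : set 'rV[R]_k := [set x | forall j, 0 <= x 0 j <= 1].

Definition open_unit_cube : set 'rV[R]_k := [set x | forall j, 0 < x 0 j < 1].

(* Only the restriction of [C] to the unit cube is constrained. *)
Definition copula (C : 'rV[R]_k -> R) : Prop :=
  exists mu : probability (k.-tuple (measurableTypeR R)) R,
    (forall j (B : set (measurableTypeR R)), measurable B ->
       mu [set y | B (tnth y j)] = uniform_prob (@ltr01 R) B) /\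
    (forall x, unit_cube x ->
       (C x)%:E = mu [set y | forall j, tnth y j <= x 0 j]).

(* C is C^1 on the closed cube: it is continuous there, and its partial
   derivatives, taken in the interior, extend continuously to the whole cube. *)
Definition continuously_differentiable_on_cube (C : 'rV[R]_k -> R) : Prop :=
  {within unit_cube, continuous C} /\
  forall j, exists2 D : 'rV[R]_k -> R,
    {within unit_cube, continuous D} &
    forall x, open_unit_cube x -> is_derive x (delta_mx 0 j : 'rV[R]_k) C (D x).

End copulas.

Section conditional_law.
Context (R : realType) (d : measure_display) (Omega : measurableType d).
Context (k : nat).

(* Given the sigma-algebra at time [T], the times [tau] have the joint
   distribution function C(M^{1,u_1}_T, ..., M^{k,u_k}_T), u_j in [0, T].  A
   coordinate may also be left unconstrained (u_j = +oo > T), and then the j-th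
   argument of C is 1, the value at +oo of any marginal distribution function;
   for T < +oo the values on [0, T]^k alone do not determine the conditional
   law of the subfamilies of [tau]. *)
Definition conditional_copula_law (P : probability Omega R)
    (F : \bar R -> set (set Omega)) (C : 'rV[R]_k -> R)
    (M : 'I_k -> \bar R -> \bar R -> Omega -> R)
    (tau : 'I_k -> Omega -> \bar R) (T : \bar R) : Prop :=
  forall u : 'I_k -> \bar R,
    (forall j, (0 <= u j)%E /\ ((u j <= T)%E \/ u j = +oo%E)) ->
    is_condprob P (F T) [set w | forall j, (tau j w <= u j)%E]
      (fun w => C (\row_j (if (u j <= T)%E then M j (u j) T w else 1))).

(* The indices start at 0: [order_statistic tau i] is sigma_{i+1}. *)
Definition order_statistic (tau : 'I_k -> Omega -> \bar R) (i : 'I_k)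
    (w : Omega) : \bar R :=
  nth +oo%E (sort <=%O [seq tau j w | j <- enum 'I_k]) i.

Lemma order_statistic_le (tau : 'I_k -> Omega -> \bar R) (i : 'I_k) t :
  [set w | (order_statistic tau i w <= t)%E] =
  \bigcup_(I in [set I : {set 'I_k} | #|I| = i.+1])
    [set w | forall j, j \in I -> (tau j w <= t)%E].
Proof.
have le_count w : (order_statistic tau i w <= t)%E =
    (i < #|[pred j | (tau j w <= t)%E]|)%N.
  rewrite /order_statistic; set s := [seq tau j w | j <- enum 'I_k].
  have -> : #|[pred j | (tau j w <= t)%E]| =
      count (>=%O t) (sort <=%O s).
    by rewrite (permP (permEl (perm_sort _ _))) count_map cardE size_filter enumT.
  have [ilt|ige] := ltnP.
    by rewrite nth_count_le// sort_le_sorted.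
  apply/negbTE; rewrite -ltNge nth_count_gt ?sort_le_sorted//.
  by rewrite ige size_sort size_map size_enum_ord ltn_ord.
apply/seteqP; split => w /=; rewrite le_count.
  move=> /card_geqP[I /= [uI sI sub]].
  exists [set j | j \in I]%SET.
    by rewrite /= cardsE (card_uniqP uI).
  by move=> j; rewrite inE => /sub.
move=> [I /= cI Ile]; rewrite -cI; apply: subset_leq_card.
by apply/fintype.subsetP => j jI; exact: Ile.
Qed.

End conditional_law.

(* Main.v *)
Require Import Defs.
From HB Require Import structures.
From mathcomp Require Import all_boot all_order all_algebra.
From mathcomp Require Import all_classical all_reals all_analysis.
From mathcomp Require Import measurable_realfun.

(* Only the marginals of the copula matter.  Let nu_i be the law of
   (w, sigma_i w), restricted to sigma_i <= t, on F_t (x) B[0, +oo].  Since each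
   sigma_i coincides pathwise with one of the tau_j, nu_i is dominated by the sum
   of the corresponding laws of the tau_j.  Putting all the other coordinates at
   +oo in the conditional law shows that M^j is the iM family of tau_j on [0, T],
   so the law of (w, tau_j w) has a density with respect to Q(dw) dA_v(w).
   Domination passes from F_T to the smaller sigma-algebra F_t, and the
   Radon-Nikodym theorem on F_t (x) B[0, +oo] yields a jointly measurable p with
   Q[sigma_i <= u | F_t] = \int_[0, u] p dA almost surely for each u; rational u
   and right-continuity make the exceptional set independent of u. *)

Set Implicit Arguments.
Unset Strict Implicit.
Unset Printing Implicit Defensive.
Import Order.TTheory GRing.Theory Num.Theory.
Import numFieldNormedType.Exports.

Local Open Scope classical_set_scope.
Local Open Scope ring_scope.

(** * Measures given by a density *)

Section density.
Local Open Scope ereal_scope.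
Context d (T : measurableType d) (R : realType) (mu : {measure set T -> \bar R}).
Variable g : T -> R.

(** The two proofs are arguments because the measure structure attached to this function below
    depends on them. *)
Definition density of measurable_fun setT g & (forall x, 0 <= g x)%R :=
  fun A => \int[mu]_(x in A) (g x)%:E.

Hypotheses (mg : measurable_fun setT g) (g0 : forall x, (0 <= g x)%R).
Local Notation nu := (density mg g0).

Let nu0 : nu set0 = 0. Proof. exact: integral_set0. Qed.
Let nu_ge0 A : 0 <= nu A.
Proof. by apply: integral_ge0 => x _; rewrite lee_fin. Qed.
Let nu_sigma_additive : semi_sigma_additive nu.
Proof.
apply: semi_sigma_additive_nng_induced; first exact/measurable_EFinP.
by move=> x; rewrite lee_fin.
Qed.

HB.instance Definition _ := isMeasure.Build _ _ _ nu nu0 nu_ge0 nu_sigma_additive.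

Import HBNNSimple.

Lemma ge0_integral_density (f : T -> \bar R) :
  measurable_fun setT f -> (forall x, 0 <= f x) ->
  \int[nu]_x f x = \int[mu]_x (f x * (g x)%:E).
Proof.
move=> mf f0; pose f_ := nnsfun_approx measurableT mf.
have mgE : measurable_fun setT (EFin \o g) by exact/measurable_EFinP.
have f_f x : (f_ n x)%:E @[n --> \oo] --> f x.
  by apply: cvg_nnsfun_approx => // *; exact: f0.
transitivity (limn (fun n => \int[nu]_x (f_ n x)%:E)).
  rewrite -monotone_convergence//.
  - by apply: eq_integral => y _; apply/esym/cvg_lim => //; exact: f_f.
  - by move=> n; exact/measurable_EFinP/measurable_funP.
  - by move=> n y _; rewrite lee_fin.
  - by move=> y _ m n mn; rewrite lee_fin; exact/lefP/nd_nnsfun_approx.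
rewrite [X in limn X](_ : _ = (fun n => \int[mu]_x ((f_ n x)%:E * (g x)%:E))).
  rewrite -monotone_convergence//; last 3 first.
    - by move=> n /=; apply: emeasurable_funM => //; exact/measurable_EFinP.
    - by move=> n x _ /=; rewrite mule_ge0// lee_fin.
    - move=> x _ m n mn; apply: lee_wpmul2r; first by rewrite lee_fin.
      by rewrite lee_fin; exact/lefP/nd_nnsfun_approx.
  apply: eq_integral => x _; apply/cvg_lim => //.
  by apply: cvgeZr => //; exact: f_f.
(* A simple function is a finite sum over its values, which reduces the identity to the indicator of
   a level set; there it is the definition of [density]. *)
apply/funext => n.
pose h r x := (r * \1_(f_ n @^-1` [set r]) x)%:E.
have h0 r x : 0 <= h r x by rewrite /h nnfun_muleindic_ge0.
have mh r : measurable_fun setT (h r) by exact/measurable_EFinP/measurable_funM.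
have f_E x : (f_ n x)%:E = \sum_(r \in range (f_ n)) h r x.
  by rewrite fimfunE -fsumEFin.
transitivity (\int[nu]_x \sum_(r \in range (f_ n)) h r x).
  by apply: eq_integral => x _; rewrite f_E.
transitivity (\int[mu]_x \sum_(r \in range (f_ n)) (h r x * (g x)%:E)); last first.
  by apply: eq_integral => x _; rewrite f_E ge0_mule_fsuml.
rewrite !ge0_integral_fsum//; last 2 first.
- by move=> y; exact: emeasurable_funM (mh y) mgE.
- by move=> y x _; apply: mule_ge0 => //; rewrite lee_fin.
rewrite /h; apply: eq_fsbigr => r _.
have mr : measurable (f_ n @^-1` [set r]) by exact: measurable_funPTI.
rewrite integralZl_indic_nnsfun// integral_indic// setIT.
have [r0|r0] := leP 0%R r; last first.
  by rewrite preimage_nnfun0// measure0 mule0 integral0_eq// => x _;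
    rewrite indic0 mulr0 mul0e.
under [RHS]eq_integral => x _ do rewrite EFinM -muleA.
rewrite ge0_integralZl//; last 2 first.
- by apply: emeasurable_funM => //; exact/measurable_EFinP.
- by move=> x _; rewrite mule_ge0 ?lee_fin.
congr (_ * _); rewrite /density/= [LHS]integral_mkcond.
apply: eq_integral => x _; rewrite patchE indicE.
by case: ifPn => _; rewrite ?mul1e ?mul0e.
Qed.

End density.

(** * Reduction of kernels that are finite on a countable cover to bounded ones *)

Lemma measurable_funV_gt0 d (T : measurableType d) (R : realType) (f : T -> R) :
  measurable_fun setT f -> (forall x, 0 < f x) ->
  measurable_fun setT (fun x => (f x)^-1).
Proof.
move=> mf f0; rewrite (_ : (fun x => _) = (@powR R ^~ (- 1)) \o f).
  by apply: measurableT_comp => //; exact: measurable_powR.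
by apply/funext => x /=; rewrite powR_inv1// ltW.
Qed.

Section bounded_equivalent_kernel.
Local Open Scope ereal_scope.
Context d d' (X : measurableType d) (Y : measurableType d') (R : realType).
Variables (m : X -> {measure set Y -> \bar R}) (D : (set Y)^nat).
Hypotheses (mD : forall n, measurable (D n)) (DT : \bigcup_n D n = setT).
Hypothesis D_fin : forall n x, m x (D n) < +oo.
Hypothesis measurable_m : forall n U, measurable U ->
  measurable_fun setT (fun x => m x (U `&` D n)).

Let E := seqDU D.

Let mE n : measurable (E n). Proof. exact: seqDU_measurable. Qed.

Let ET : \bigcup_n E n = setT. Proof. by rewrite -seqDU_bigcup_eq. Qed.

Let tE : trivIset setT E. Proof. exact: trivIset_seqDU. Qed.

Let measurable_mE n U : measurable U ->
  measurable_fun setT (fun x => m x (U `&` E n)).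
Proof.
move=> mU; rewrite (_ : U `&` E n = (U `&` E n) `&` D n).
  by apply: measurable_m; exact: measurableI.
by rewrite -setIA (setIidl (@subset_seqDU _ _ _)).
Qed.

(** This factor brings the mass of the [n]-th piece down to at most 2^-(n+1); adding 1 in the
    denominator keeps it positive when [D n] is null. *)
Let c n x : R := ((2 ^ n.+1)%:R^-1 / (1 + fine (m x (D n))))%R.

Let c_gt0 n x : (0 < c n x)%R.
Proof.
by rewrite divr_gt0 ?invr_gt0 ?ltr0n ?expn_gt0// ltr_wpDr// fine_ge0.
Qed.

Let mc n : measurable_fun setT (c n).
Proof.
apply: measurable_funM => //; apply: measurable_funV_gt0; last first.
  by move=> x; rewrite ltr_wpDr// fine_ge0.
apply: measurable_funD => //; apply: measurableT_comp => //.
by have := measurable_m n measurableT; rewrite setTI.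
Qed.

(** The default 0 is never taken: the pieces [E n] are disjoint and cover the space, so each [y] has
    exactly one index. *)
Let idx y : nat := xget 0%N [set n | E n y].

Let idxP n y : E n y -> idx y = n.
Proof.
move=> Eny; apply: xget_unique => // k /= Eky.
by apply: tE => //; exists y.
Qed.

(* Finite kernels have to be uniformly bounded, which [m] (later dA) is not.
   This everywhere positive density brings the total mass below 1 without
   changing the null sets. *)
Definition kernel_weight (xy : X * Y) : R := c (idx xy.2) xy.1.

Let g := kernel_weight.

Lemma kernel_weight_gt0 xy : (0 < g xy)%R. Proof. exact: c_gt0. Qed.

Lemma measurable_kernel_weight : measurable_fun setT g.
Proof.
rewrite (_ : setT = \bigcup_n (setT `*` E n)); last first.
  by rewrite -setX_bigcupr ET setXTT.
apply/measurable_fun_bigcup => [n|n]; first exact: measurableX.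
apply: (@eq_measurable_fun _ _ _ _ _ (fun xy : X * Y => c n xy.1)).
  by move=> [x y]; rewrite inE => -[_ /= Eny]; rewrite /g/kernel_weight/= (idxP Eny).
by apply: measurable_funTS; apply: measurableT_comp.
Qed.

Let mg x : measurable_fun setT (fun y => g (x, y)).
Proof. exact: measurableT_comp measurable_kernel_weight _. Qed.

Let g0 x y : (0 <= g (x, y))%R. Proof. exact/ltW/kernel_weight_gt0. Qed.

Definition weighted_kernel of (forall n x, m x (D n) < +oo) :=
  fun x => density (m x) (mg x) (g0 x) : {measure set Y -> \bar R}.

Let K := weighted_kernel D_fin.

(** The weight is constant, equal to [c n x], on each piece [E n]. *)
Let K_sum x U : measurable U ->
  K x U = \sum_(n <oo) (c n x)%:E * m x (U `&` E n).
Proof.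
move=> mU; rewrite /K /weighted_kernel/= /density.
rewrite -{1}(setIT U) -ET setI_bigcupr ge0_integral_bigcup/=.
- apply: eq_eseriesr => n _.
  rewrite -[in RHS]integral_cst; last exact: measurableI.
  by apply: eq_integral => y; rewrite inE => -[_ Eny]; rewrite /g/kernel_weight/= (idxP Eny).
- by move=> n; exact: measurableI.
- exact/measurable_funTS/measurable_EFinP.
- by move=> y _; rewrite lee_fin.
- by apply: trivIset_setIl.
Qed.

Let measurable_K U : measurable U -> measurable_fun setT (K ^~ U).
Proof.
move=> mU; under eq_fun do rewrite K_sum//.
apply: ge0_emeasurable_sum => [n x _ _|n _].
  by rewrite mule_ge0// lee_fin ltW.
by apply: emeasurable_funM; [exact/measurable_EFinP|exact: measurable_mE].
Qed.

HB.instance Definition _ := isKernel.Build _ _ _ _ _ (weighted_kernel D_fin) measurable_K.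

Let K_uub : measure_fam_uub K.
Proof.
(* The pieces add up to at most the sum of 2^-(n+1), that is 1; the uniform bound has to be strict,
   hence 2. *)
exists 2%R => x; rewrite K_sum//.
apply: (@le_lt_trans _ _ 1); last by rewrite lte_fin ltr1n.
apply: le_trans (epsilon_trick0 xpredT (@ler01 R)).
apply: lee_nneseries => n _ => [_|].
  by rewrite mule_ge0// lee_fin ltW.
rewrite setTI; apply: (@le_trans _ _ ((c n x)%:E * m x (D n))).
  apply: lee_wpmul2l; first by rewrite lee_fin ltW.
  by rewrite le_measure ?inE//; exact: subset_seqDU.
rewrite -(@fineK _ (m x (D n))) ?ge0_fin_numE// -EFinM lee_fin.
rewrite /c -mulrA mul1r ler_piMr ?invr_ge0//.
rewrite mulrC ler_pdivrMr ?mul1r; first by rewrite lerDr.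
by rewrite ltr_wpDr// fine_ge0.
Qed.

HB.instance Definition _ := Kernel_isFinite.Build _ _ _ _ R (weighted_kernel D_fin) K_uub.

Lemma integral_weighted_kernel x (f : Y -> \bar R) :
  measurable_fun setT f -> (forall y, 0 <= f y) ->
  \int[K x]_y f y = \int[m x]_y (f y * (g (x, y))%:E).
Proof. by move=> mf f0; rewrite ge0_integral_density. Qed.

(** Integrating [q] against [m x] is integrating [q / g] against the finite kernel [K x], where
    measurability in the parameter is available. *)
Lemma measurable_integral_section (q : X * Y -> R) (U : set Y) :
  measurable_fun setT q -> (forall z, 0 <= q z)%R -> measurable U ->
  measurable_fun setT (fun x => \int[m x]_(y in U) (q (x, y))%:E).
Proof.
move=> mq q0 mU.
pose f := (EFin \o (fun z => q z / g z)%R) \_ (setT `*` U).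
have f0 z : 0 <= f z.
  rewrite /f patchE; case: ifPn => // _; rewrite /= lee_fin.
  by apply: divr_ge0 => //; exact/ltW/kernel_weight_gt0.
have mf : measurable_fun setT f.
  apply/(measurable_restrictT _ _).1; first exact: measurableX.
  apply/measurable_funTS/measurable_EFinP/measurable_funM => //.
  apply: measurable_funV_gt0; first exact: measurable_kernel_weight.
  exact: kernel_weight_gt0.
rewrite (_ : (fun x => _) = (fun x => \int[K x]_y f (x, y))).
  exact: measurable_fun_integral_finite_kernel.
apply/funext => x; rewrite integral_weighted_kernel//; last first.
  by apply: (@measurableT_comp _ _ _ _ _ _ f).
rewrite integral_mkcond; apply: eq_integral => y _.
rewrite /f !patchE (_ : ((x, y) \in setT `*` U) = (y \in U)).
  case: ifPn => _; last by rewrite mul0e.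
  by rewrite -EFinM divfK// gt_eqF// c_gt0.
apply/idP/idP => [|Uy]; first by rewrite !inE => -[].
by rewrite inE; split => //=; exact: set_mem.
Qed.

End bounded_equivalent_kernel.

(** * Composition of a probability with a kernel *)

Section semidirect_product.
Local Open Scope ereal_scope.
Context d0 d d' (T : measurableType d0) (X : measurableType d)
  (Y : measurableType d') (R : realType).
Variables (P : probability T R) (phi : T -> X) (K : R.-fker X ~> Y).
Hypothesis mphi : measurable_fun setT phi.

(** The kernel sending w to the product of the Dirac mass at [phi w] with [K (phi w)]. The [unit]
    component is the source of the constant kernel [P] with which it is composed. *)
Definition graph_kernel of measurable_fun setT phi :
  unit * T -> {measure set (X * Y) -> \bar R}.
Proof.
move=> ut; refine (pushforward (K (phi ut.2)) (pair (phi ut.2))).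
exact: pair1_measurable.
Defined.

Let measurable_graph_kernel U : measurable U ->
  measurable_fun setT (graph_kernel mphi ^~ U).
Proof.
move=> mU; rewrite (_ : (fun ut => _) =
    (fun x => K x (xsection U x)) \o (phi \o snd)); last first.
  by apply/funext => ut /=; rewrite /pushforward/= xsectionE.
apply: measurableT_comp; last exact: measurableT_comp.
by apply: measurable_fun_xsection_finite_kernel; rewrite inE.
Qed.

HB.instance Definition _ :=
  isKernel.Build _ _ _ _ _ (graph_kernel mphi) measurable_graph_kernel.

Let graph_kernel_uub : measure_fam_uub (graph_kernel mphi).
Proof. by have [r Kr] := measure_uub K; exists r => ut; exact: Kr. Qed.

HB.instance Definition _ :=
  Kernel_isFinite.Build _ _ _ _ R (graph_kernel mphi) graph_kernel_uub.

(** The measure P(dw) K(phi w, dy), carried to [X * Y] by [phi]. *)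
Definition semidirect : {measure set (X * Y) -> \bar R} :=
  mkcomp (kprobability (measurable_cst (P : pprobability T R)) :
    unit -> {measure set T -> \bar R}) (graph_kernel mphi) tt.

Lemma semidirectE U : measurable U ->
  semidirect U = \int[P]_t K (phi t) (xsection U (phi t)).
Proof.
by move=> mU; apply: eq_integral => t _; rewrite /= /pushforward xsectionE.
Qed.

Lemma integral_semidirect (f : X * Y -> \bar R) :
  measurable_fun setT f -> (forall z, 0 <= f z) ->
  \int[semidirect]_z f z = \int[P]_t \int[K (phi t)]_y f (phi t, y).
Proof.
move=> mf f0; rewrite integral_kcomp//; apply: eq_integral => t _.
by rewrite ge0_integral_pushforward.
Qed.

Lemma semidirect_fin_num_fun : fin_num_fun semidirect.
Proof.
apply: lty_fin_num_fun; have [r Kr] := measure_uub K.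
rewrite semidirectE//; apply: (@le_lt_trans _ _ (\int[P]_t (cst r%:E t))).
  apply: ge0_le_integral => //.
  - apply: (@measurableT_comp _ _ _ _ _ _ (fun x => K x (xsection setT x))) => //.
    by apply: measurable_fun_xsection_finite_kernel; rewrite inE.
  - by move=> t _; apply: le_trans (ltW (Kr (phi t))); rewrite le_measure ?inE//;
      exact: measurable_xsection.
rewrite integral_cst//. rewrite [X in _ * X](_ : _ = 1) ?mule1 ?ltry//.
exact: probability_setT.
Qed.

End semidirect_product.

(** * Measurability of a measure in a parameter, and uniqueness of measures on a product *)

Lemma measurable_fun_measureI d d' (X : measurableType d)
    (Y : measurableType d') (R : realType)
    (m : X -> {measure set Y -> \bar R}) (G : set (set Y)) (S : set Y) :
  @measurable _ Y = <<s G >> -> setI_closed G -> measurable S ->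
  (forall x, m x S < +oo)%E ->
  measurable_fun setT (m ^~ S) ->
  (forall A, G A -> measurable_fun setT (fun x => m x (A `&` S))) ->
  forall A, measurable A -> measurable_fun setT (fun x => m x (A `&` S)).
Proof.
move=> GE GI mS S_fin mmS mG.
(* The good sets form a lambda-system containing the pi-system [G]. Finiteness of [m x S] is what
   allows subtraction for proper differences. *)
pose H := [set A | measurable A /\ measurable_fun setT (fun x => m x (A `&` S))].
suff : @measurable _ Y `<=` H by move=> + A mA => /(_ A mA)[].
rewrite GE; apply: (lambda_system_subset GI) => //; last first.
  by move=> A GA; split; [rewrite GE; exact: sub_sigma_algebra|exact: mG].
split => //; first by split => //; rewrite setTI.
- move=> A B BA [mA mmA] [mB mmB]; split; first exact: measurableD.
  rewrite (_ : (fun x => _) = (fun x => m x (A `&` S) - m x (B `&` S)))%E.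
    exact: emeasurable_funB.
  apply/funext => x; rewrite (_ : (A `\` B) `&` S = (A `&` S) `\` (B `&` S)).
  rewrite measureD; last 3 first.
  - exact: measurableI.
  - exact: measurableI.
  - by apply: le_lt_trans (S_fin x); rewrite le_measure ?inE//; exact: measurableI.
  by rewrite setIACA setIid (setIidr BA).
  by apply/seteqP; split => y /=; tauto.
- move=> F ndF HF; have mF n : measurable (F n) by have [] := HF n.
  have mUF : measurable (\bigcup_n F n) by exact: bigcupT_measurable.
  split => //; apply: (emeasurable_fun_cvg (fun n x => m x (F n `&` S))).
    by move=> n; have [] := HF n.
  move=> x _; rewrite setI_bigcupl; apply: nondecreasing_cvg_mu.
  + by move=> n; exact: measurableI.
  + by rewrite -setI_bigcupl; exact: measurableI.
  + by move=> i j ij; apply/subsetPset; apply: setSI; exact/subsetPset/ndF.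
Qed.

Lemma lebesgue_stieltjes_measure_itv_oc (R : realType) (f : cumulative R R)
    (a b : R) : lebesgue_stieltjes_measure f `]a, b]%classic =
  (f (Num.max a b) - f a)%:E.
Proof.
have [ab|ba] := leP a b; last first.
  by rewrite set_itv_ge ?bnd_simp -?leNgt ?ltW// subrr measure0.
transitivity (wlength f `]a, b]%classic); last exact: wlength_itv_bnd.
rewrite /lebesgue_stieltjes_measure/= /measure_extension/= measurable_mu_extE//.
exact: is_ocitv.
Qed.

(** Half-open intervals generate the Borel sets, and their mass is a difference of two path values.
    Only values up to [b] enter, so an adapted path gives a measure on times up to [b] that is
    measurable with respect to the information at [b]. *)
Lemma measurable_lebesgue_stieltjes d (X : measurableType d) (R : realType)
    (f : X -> cumulative R R) (a b : R) :
  (forall r, r <= b -> measurable_fun setT (fun x => f x r)) ->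
  forall A : set R, measurable A ->
    measurable_fun setT (fun x => lebesgue_stieltjes_measure (f x) (A `&` `]a, b])).
Proof.
move=> mf; have moc c e : e <= b -> measurable_fun setT
    (fun x => lebesgue_stieltjes_measure (f x) `]c, e]%classic).
  move=> eb; under eq_fun do rewrite lebesgue_stieltjes_measure_itv_oc.
  apply/measurable_EFinP; have [ce|ec] := leP c e.
    by apply: measurable_funB; apply: mf => //; exact: le_trans ce eb.
  by under eq_fun do rewrite subrr; exact: measurable_cst.
apply: (@measurable_fun_measureI _ _ _ (measurableTypeR R) _ _ (@ocitv R)) => //.
- exact: ocitvI.
- by move=> x; rewrite [ltLHS](lebesgue_stieltjes_measure_itv_oc (f x) a b) ltry.
- exact: moc.
- move=> _ [[c e] _ <-] /=.
  rewrite (_ : _ `&` _ = `]Num.max c a, Num.min e b]%classic).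
    by apply: moc; rewrite ge_min lexx orbT.
  apply/seteqP; split => x /=; rewrite !in_itv/= gt_max le_min.
    by move=> [/andP[-> ->] /andP[-> ->]].
  by move=> /andP[/andP[-> ->] /andP[-> ->]].
Qed.

(** The rectangles of the hypothesis are stable under intersection, contain the whole space (take
    [u] to be +oo) and generate the product sigma-algebra. *)
Lemma eq_finite_measure_prod_ereal d (X : measurableType d) (R : realType)
    (m1 m2 : {measure set (X * \bar R) -> \bar R}) :
  (m1 setT < +oo)%E ->
  (forall A u, measurable A ->
    m1 (A `*` [set y | (y <= u)%E]) = m2 (A `*` [set y | (y <= u)%E])) ->
  forall B, measurable B -> m1 B = m2 B.
Proof.
move=> m1_fin m12.
have mle (u : \bar R) : measurable [set y : \bar R | (y <= u)%E].
  by rewrite -(setTI [set _ | _]); exact: emeasurable_fun_infty_c.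
pose G := [set B | exists (A : set X) (u : \bar R), measurable A /\
  B = A `*` [set y : \bar R | (y <= u)%E]].
have GE : @measurable _ (X * \bar R)%type = <<s G >>.
  apply/seteqP; split; last first.
    apply: smallest_sub; first exact: sigma_algebra_measurable.
    by move=> _ [A [u [mA ->]]]; exact: measurableX.
  pose Z := g_sigma_algebraType G.
  have m1st : measurable_fun setT (fst : Z -> X).
    move=> _ A mA; rewrite setTI; apply: sub_sigma_algebra.
    exists A, +oo%E; split => //.
    by apply/seteqP; split => -[x y] //=; [rewrite leey|case].
  have m2nd : measurable_fun setT (snd : Z -> \bar R).
    apply: (measurability _ (ErealGenOInfty.measurableE R)) => _ /= -[_ [r ->] <-].
    rewrite setTI (_ : _ @^-1` _ = ~` (setT `*` [set y | (y <= r%:E)%E])).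
      by apply: measurableC; apply: sub_sigma_algebra; exists setT, r%:E.
    apply/seteqP; split => -[x y] /=; rewrite in_itv/= andbT ltNge.
      by move=> /negP yr [_].
    by move=> yr; apply/negP => ?; apply: yr.
  have mid : measurable_fun setT (id : Z -> (X * \bar R)%type).
    rewrite (_ : id = fun z => (z.1, z.2)); first exact: measurable_fun_pair.
    by apply/funext => -[].
  by move=> B mB; have := mid measurableT B mB; rewrite setTI.
apply: (measure_unique G (fun=> setT)) => //.
- move=> _ _ [A [u [mA ->]]] [A' [u' [mA' ->]]].
  exists (A `&` A'), (Order.min u u'); split; first exact: measurableI.
  rewrite -setXI; congr (_ `*` _).
  by apply/seteqP; split => y /=; rewrite le_min => /andP.
- move=> _; exists setT, +oo%E; split => //.
  by apply/seteqP; split => -[x y] //= _; rewrite leey.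
- by rewrite bigcup_const.
- by move=> _ [A [u [mA ->]]]; exact: m12.
Qed.

Lemma finite_measure_of d (T : measurableType d) (R : realType)
    (m : {measure set T -> \bar R}) : fin_num_fun m ->
  exists m' : {finite_measure set T -> \bar R}, m' = m :> (set T -> \bar R).
Proof.
move=> mfin; have m_fin : (m setT < +oo)%E by rewrite ltey_eq mfin.
exists (mfrestr measurableT m_fin).
by apply/funext => A; congr (m _); exact: setIT.
Qed.

(** * The law of a marked point: absolute continuity and density *)

Section marked_law.
Local Open Scope ereal_scope.
Context d0 d (T : measurableType d0) (X : measurableType d) (R : realType).
Variables (P : probability T R) (phi : T -> X) (sigma : T -> \bar R).
Variable S : set (\bar R).
Hypotheses (mphi : measurable_fun setT phi) (msigma : measurable_fun setT sigma).
Hypothesis mS : measurable S.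
Variables (m : X -> {measure set (\bar R) -> \bar R}) (D : (set (\bar R))^nat).
Hypotheses (mD : forall n, measurable (D n)) (DT : \bigcup_n D n = setT).
Hypothesis D_fin : forall n x, m x (D n) < +oo.
Hypothesis measurable_m : forall n U, measurable U ->
  measurable_fun setT (fun x => m x (U `&` D n)).

Local Notation Y := (\bar R).
Let K : R.-fker X ~> Y := weighted_kernel mD DT measurable_m D_fin.
Let g : X * Y -> R := kernel_weight m D.
Let mu := semidirect P K mphi.

Let mg : measurable_fun setT g. Proof. exact: measurable_kernel_weight. Qed.

Let g_gt0 z : (0 < g z)%R. Proof. exact: kernel_weight_gt0. Qed.

Let K_eq0 x U : measurable U -> K x U = 0 <-> m x U = 0.
Proof.
move=> mU; have mgx : measurable_fun setT (fun y => (g (x, y))^-1)%R.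
  by apply: (@measurableT_comp _ _ _ _ _ _ (fun z => (g z)^-1)%R) => //;
    exact: measurable_funV_gt0.
split=> [KU|mU0]; last first.
  apply: null_set_integral => //.
  by apply/measurable_EFinP/measurable_funTS; exact: measurableT_comp.
(* Integrating 1/g against [K x] undoes the weight and gives back [m x U]. *)
have : \int[K x]_(y in U) (g (x, y))^-1%:E = 0.
  by apply: null_set_integral => //; exact/measurable_EFinP/measurable_funTS.
rewrite integral_mkcond integral_weighted_kernel//=; last 2 first.
- apply/(measurable_restrictT _ _).1 => //.
  exact/measurable_EFinP/measurable_funTS.
- by move=> y; rewrite patchE; case: ifPn => // _; rewrite lee_fin invr_ge0 ltW.
move=> <-; rewrite -[in LHS](setIT U) -integral_indic//.
apply: eq_integral => y _; rewrite patchE indicE; case: ifPn => _; last by rewrite mul0e.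
by rewrite -EFinM mulVf// gt_eqF.
Qed.

(** A nonnegative function has integral 0 exactly when it vanishes almost everywhere, and [K x] has
    the same null sets as [m x]. *)
Let mu_eq0 B : measurable B ->
  mu B = 0 <-> {ae P, forall w, m (phi w) (xsection B (phi w)) = 0}.
Proof.
move=> mB; rewrite semidirectE//.
have mK : measurable_fun setT (fun w => K (phi w) (xsection B (phi w))).
  apply: (@measurableT_comp _ _ _ _ _ _ (fun x => K x (xsection B x))) => //.
  by apply: measurable_fun_xsection_finite_kernel; rewrite inE.
rewrite [X in X = 0](_ : _ = \int[P]_w `|K (phi w) (xsection B (phi w))|); last first.
  by apply: eq_integral => w _; rewrite gee0_abs.
rewrite ae_eq_integral_abs//.
have mB' w : measurable (xsection B (phi w)) by exact: measurable_xsection.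
split; first by apply: filterS => w /(_ Logic.I) /(K_eq0 _ (mB' w)).
by apply: filterS => w mw0 _; exact/(K_eq0 _ (mB' w)).
Qed.

Let integral_mu (q : X * Y -> R) F U : measurable F -> measurable U ->
  measurable_fun setT q -> (forall z, 0 <= q z)%R ->
  \int[mu]_(z in F `*` U) (q z)%:E =
  \int[P]_(w in phi @^-1` F) \int[m (phi w)]_(v in U) (q (phi w, v) * g (phi w, v))%:E.
Proof.
move=> mF mU mq q0.
have mFU : measurable (F `*` U) by exact: measurableX.
rewrite integral_mkcond integral_semidirect; last 2 first.
- by apply/(measurable_restrictT _ _).1 => //; exact/measurable_EFinP/measurable_funTS.
- by move=> z; rewrite patchE; case: ifPn => // _; rewrite lee_fin.
rewrite [RHS]integral_mkcond; apply: eq_integral => w _.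
rewrite integral_weighted_kernel; last 2 first.
- apply: (@measurableT_comp _ _ _ _ _ _ (fun z => ((EFin \o q) \_ (F `*` U)) z)) => //.
  by apply/(measurable_restrictT _ _).1 => //; exact/measurable_EFinP/measurable_funTS.
- by move=> v; rewrite patchE; case: ifPn => // _; rewrite lee_fin.
rewrite patchE; case: ifPn => [/[!inE] Fw|/negP Fw]; last first.
  apply: integral0_eq => v _; rewrite patchE; case: ifPn; last by rewrite mul0e.
  by rewrite inE => -[/= Fw' _]; case: Fw; rewrite inE.
rewrite [RHS]integral_mkcond; apply: eq_integral => v _; rewrite !patchE.
have -> : ((phi w, v) \in F `*` U) = (v \in U).
  apply/idP/idP => [|Uv]; first by rewrite !inE => -[].
  by rewrite inE; split => //=; exact: set_mem.
by case: ifPn => _; rewrite ?mul0e// EFinM.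
Qed.

Let mpair : measurable_fun setT (fun w => (phi w, sigma w)).
Proof. exact: measurable_fun_pair. Qed.

Let mSsigma : measurable (sigma @^-1` S).
Proof. by rewrite -[X in measurable X]setTI; exact: msigma. Qed.

(** The law of (phi w, sigma w) restricted to the event that [sigma] falls in [S]. *)
Let nu : {measure set (X * Y) -> \bar R}.
Proof.
refine (pushforward (mrestr P mSsigma) (fun w => (phi w, sigma w))).
exact: mpair.
Defined.

Let nuE B : nu B = P [set w | B (phi w, sigma w) /\ S (sigma w)].
Proof. by []. Qed.

(** The hypothesis on rectangles identifies [nu] with the measure of density [p / g] with respect to
    [mu], and such a measure vanishes on the null sets of [mu]. Dividing by [g] cancels the weight
    in [mu]. *)
Lemma marked_law_null (p : X * Y -> R) :
  measurable_fun setT p -> (forall z, 0 <= p z)%R ->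
  (forall F u, measurable F ->
    P [set w | [/\ F (phi w), sigma w <= u & S (sigma w)]] =
    \int[P]_(w in phi @^-1` F) \int[m (phi w)]_(v in [set v | v <= u])
      (p (phi w, v))%:E) ->
  forall B, measurable B ->
    {ae P, forall w, m (phi w) (xsection B (phi w)) = 0} ->
    P [set w | B (phi w, sigma w) /\ S (sigma w)] = 0.
Proof.
move=> mp p0 Pp B mB /mu_eq0 muB.
have mpg : measurable_fun setT (fun z => p z / g z)%R.
  by apply: measurable_funM => //; exact: measurable_funV_gt0.
have pg0 z : (0 <= p z / g z)%R by rewrite divr_ge0// ltW.
rewrite -nuE (@eq_finite_measure_prod_ereal _ _ _ nu (density mu mpg pg0))//.
- by apply: null_set_integral; [|exact/measurable_funTS/measurable_EFinP|exact: muB].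
- rewrite nuE; apply: le_lt_trans (ltry 1); apply: probability_le1.
  rewrite (_ : [set _ | _] = sigma @^-1` S)//.
  by apply/seteqP; split => w //= [].
- move=> F u mF; rewrite nuE.
  have mle : measurable [set v : Y | v <= u].
    by rewrite -(setTI [set _ | _]); exact: emeasurable_fun_infty_c.
  transitivity (P [set w | [/\ F (phi w), sigma w <= u & S (sigma w)]]).
    by congr (P _); apply/seteqP; split => w /= => [[[]]//|[]//].
  rewrite Pp// [RHS]integral_mu//; apply: eq_integral => w _.
  by apply: eq_integral => v _; rewrite divfK// gt_eqF.
Qed.

(** Radon-Nikodym for the finite measures [nu] and [mu]; multiplying the derivative by [g] converts
    it from a density against [K] to one against [m]. *)
Lemma marked_law_density :
  (forall B, measurable B ->
    {ae P, forall w, m (phi w) (xsection B (phi w)) = 0} ->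
    P [set w | B (phi w, sigma w) /\ S (sigma w)] = 0) ->
  exists p : X * Y -> R,
    [/\ measurable_fun setT p, forall z, (0 <= p z)%R &
    forall F U, measurable F -> measurable U ->
      P [set w | [/\ F (phi w), U (sigma w) & S (sigma w)]] =
      \int[P]_(w in phi @^-1` F) \int[m (phi w)]_(v in U) (p (phi w, v))%:E].
Proof.
move=> dom.
have nufin : fin_num_fun nu.
  apply: lty_fin_num_fun; rewrite nuE; apply: le_lt_trans (ltry 1).
  apply: probability_le1; rewrite (_ : [set _ | _] = sigma @^-1` S)//.
  by apply/seteqP; split => w //= [].
have mufin : fin_num_fun mu by exact: semidirect_fin_num_fun.
have [nu' nu'E] := finite_measure_of nufin.
have [mu' mu'E] := finite_measure_of mufin.
have numu : nu' `<< mu'.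
  apply/null_content_dominatesP => B mB muB; rewrite nu'E.
  by apply: dom => //; apply/mu_eq0 => //; rewrite -muB -mu'E.
pose f := Radon_Nikodym_SigmaFinite.f nu' mu'.
have f0 z : 0 <= f z by exact: Radon_Nikodym_SigmaFinite.f_ge0.
have f_fin z : f z \is a fin_num by exact: Radon_Nikodym_SigmaFinite.f_fin_num.
have mf : measurable_fun setT (fine \o f).
  apply: measurableT_comp => //.
  exact: measurable_int (Radon_Nikodym_SigmaFinite.f_integrable numu).
have ff0 z : (0 <= (fine \o f) z)%R by exact: fine_ge0.
exists (fun z => fine (f z) * g z)%R; split.
- exact: measurable_funM.
- by move=> z; apply: mulr_ge0; [exact: ff0|exact: ltW].
move=> F U mF mU; transitivity (nu' (F `*` U)).
  by rewrite nu'E; congr (P _); apply/seteqP; split => w /= => [[]//|[[]]//].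
rewrite (Radon_Nikodym_SigmaFinite.f_integral numu); last exact: measurableX.
rewrite -[RHS](integral_mu mF mU mf ff0).
transitivity (\int[mu']_(z in F `*` U) ((fine \o f) z)%:E).
  by apply: eq_integral => z _; rewrite /= (fineK (f_fin z)).
by apply: eq_measure_integral => B _ _; rewrite -mu'E.
Qed.

End marked_law.

(** * The random measure dA restricted to [0, t] *)

Section indicator_density.
Local Open Scope ereal_scope.
Context d (T : measurableType d) (R : realType) (mu : {measure set T -> \bar R}).
Variables (E : set T) (mE : measurable E).

Let indic_ge0 x : (0 <= \1_E x :> R)%R. Proof. by rewrite indicE. Qed.

Definition restricted : {measure set T -> \bar R} :=
  density mu (measurable_indic mE) indic_ge0.

Lemma restrictedE U : measurable U -> restricted U = mu (U `&` E).
Proof. by move=> mU; rewrite /restricted/= /density integral_indic// setIC. Qed.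

Lemma integral_restricted U (f : T -> \bar R) : measurable U ->
  measurable_fun setT f -> (forall x, 0 <= f x) ->
  \int[restricted]_(x in U) f x = \int[mu]_(x in U `&` E) f x.
Proof.
move=> mU mf f0; rewrite integral_mkcond ge0_integral_density; last 2 first.
- by apply/(measurable_restrictT _ _).1 => //; exact/measurable_funTS.
- by move=> x; rewrite patchE; case: ifPn.
rewrite [RHS]integral_mkcond; apply: eq_integral => x _.
rewrite !patchE indicE in_setI.
by do 2! case: (_ \in _); rewrite ?mule1 ?mule0 ?mul0e.
Qed.

End indicator_density.

Section stopped_random_measure.
Local Open Scope ereal_scope.
Context (R : realType) (d : measure_display) (Omega : measurableType d).
Variables (A : increasing_process R Omega) (G : set (set Omega)) (t : \bar R).
Hypothesis t0 : 0 <= t.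
Hypothesis mpath : forall s : R, s%:E <= t -> measurable_wrt G (fun w => ip_path A w s).
Hypothesis mjump : t = +oo -> measurable_wrt G (fun w => (ip_jump A w)%:num%R).

Lemma ip_measureE w B : ip_measure A w B =
  lebesgue_stieltjes_measure (ip_path A w) (EFin @^-1` B) +
  (ip_jump A w)%:num%:E * \d_(+oo : \bar R) B.
Proof. exact: measure_addE. Qed.

(** Beyond [t] the measure dA is not determined by the information [G] available at [t]; the
    restriction is what depends measurably on w under [G]. *)
Definition stopped_measure (w : g_sigma_algebraType G) :
  {measure set (\bar R) -> \bar R} :=
  restricted (ip_measure A w) (emeasurable_itv `[0, t]).

(** A cover on which the stopped measure is finite, because paths and jump are real-valued. The
    point +oo is put in every set since the bounded times alone never reach it. *)
Definition finite_horizon n : set (\bar R) := [set y | y <= n%:R%:E \/ y = +oo].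

Lemma measurable_finite_horizon n : measurable (finite_horizon n).
Proof.
rewrite (_ : finite_horizon n = [set y | y <= n%:R%:E] `|` [set +oo]).
  apply: measurableU; last exact: emeasurable_set1.
  by rewrite -(setTI [set _ | _]); exact: emeasurable_fun_infty_c.
by apply/seteqP; split.
Qed.

Lemma bigcup_finite_horizon : \bigcup_n finite_horizon n = setT.
Proof.
apply/seteqP; split => // -[r _| _|_].
- exists (Num.truncn r).+1 => //; left.
  by rewrite lee_fin ltW// truncnS_gt.
- by exists 0%N => //; right.
- by exists 0%N => //; left; rewrite leNye.
Qed.

(** The minimum of [n] and [t] as a real number; the default branch is meant for [t] equal to
    +oo. *)
Let horizon n : R := if t is r%:E then Num.min n%:R r else n%:R.

Let horizon_le n : (horizon n)%:E <= t.
Proof.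
by rewrite /horizon; case: t t0 => [r|//|//] _; rewrite ?leey// lee_fin ge_min lexx orbT.
Qed.

(** The left end -1 puts the possible atom of dA at 0 inside a half-open interval; any negative
    number would do. *)
Let preimage_horizon n U :
  EFin @^-1` (U `&` finite_horizon n `&` `[0, t]) =
  ((EFin @^-1` U `&` `[0%R, +oo[) `&` `](-1)%R, horizon n])%classic.
Proof.
have rn r : (0 <= r)%R -> (r <= horizon n)%R = (r <= n%:R)%R && (r%:E <= t).
  rewrite /horizon; case: t t0 => [s| |//] _ r0; first by rewrite le_min lee_fin.
  by rewrite leey andbT.
apply/seteqP; split => r /=; rewrite !in_itv/= andbT lee_fin.
  move=> [[Ur [rn'|//]] /andP[r0 rt]]; rewrite lee_fin in rn'.
  by rewrite rn// rn' rt (lt_le_trans _ r0)// ltrN10.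
move=> [[Ur r0] /andP[_]]; rewrite rn// => /andP[rn' rt].
by rewrite r0 rt; split => //; split => //; left; rewrite lee_fin.
Qed.

Lemma stopped_measure_fin n w : stopped_measure w (finite_horizon n) < +oo.
Proof.
have mn := measurable_finite_horizon n.
rewrite restrictedE// ip_measureE lte_add_pinfty//; last first.
  by rewrite diracE -EFinM ltry.
rewrite -(setTI (finite_horizon n)) preimage_horizon.
apply: (@le_lt_trans _ _ (lebesgue_stieltjes_measure (ip_path A w) `](-1)%R, horizon n]%classic)).
  apply: le_measure; rewrite ?inE; last by move=> r [].
    apply: measurableI; last exact: measurable_itv.
    apply: measurableI; last exact: measurable_itv.
    by rewrite preimage_setT.
  exact: measurable_itv.
by rewrite lebesgue_stieltjes_measure_itv_oc ltry.
Qed.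

Lemma measurable_stopped_measure n U : measurable U ->
  measurable_fun setT (fun w => stopped_measure w (U `&` finite_horizon n)).
Proof.
move=> mU; have mUn : measurable (U `&` finite_horizon n).
  by apply: measurableI => //; exact: measurable_finite_horizon.
under eq_fun do rewrite restrictedE// ip_measureE.
apply: emeasurable_funD.
  under eq_fun do rewrite preimage_horizon.
  apply: measurable_lebesgue_stieltjes => [r rn|].
    by apply: mpath; apply: le_trans (horizon_le n); rewrite lee_fin.
  apply: measurableI; last exact: measurable_itv.
  by rewrite -[X in measurable X]setTI; exact: EFin_measurable.
(* The point +oo belongs to [0, t] only if [t] is +oo, and exactly then the jump is known to be
   [G]-measurable. *)
rewrite diracE; case: (boolP (_ \in _)) => [|_]; last first.
  by under eq_fun do rewrite mule0; exact: measurable_cst.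
rewrite inE /= => -[_]; rewrite in_itv/= => /andP[_]; rewrite leye_eq => /eqP toy.
by under eq_fun do rewrite mule1; apply/measurable_EFinP; exact: mjump.
Qed.

End stopped_random_measure.

(** * One-dimensional marginals of a copula *)

Lemma uniform_prob01_le (R : realType) (x : R) : 0 <= x <= 1 ->
  uniform_prob (@ltr01 R) `]-oo, x]%classic = x%:E.
Proof.
move=> /andP[x0 x1]; rewrite /uniform_prob integral_uniform_pdf.
rewrite (_ : _ `&` _ = `[0, x]%classic); last first.
  apply/seteqP; split => y /=; rewrite !in_itv/=; first by move=> [-> /andP[->]].
  by move=> /andP[-> yx]; rewrite yx (le_trans yx).
rewrite (eq_integral (cst 1%E)); last first.
  move=> y; rewrite inE/= in_itv/= => /andP[y0 yx].
  by rewrite /uniform_pdf y0 (le_trans yx)// subr0 invr1.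
rewrite integral_cst//= mul1e lebesgue_measure_itv/= lte_fin.
by case: ltP => [_|x0']; rewrite ?oppr0 ?adde0//; congr EFin; apply/eqP; rewrite eq_le x0.
Qed.

(** Uniform coordinates are almost surely at most 1, so the constraints at level 1 cost only a null
    set and the remaining one has mass [a]. *)
Lemma copula_marginal (R : realType) (k : nat) (C : 'rV[R]_k -> R) (j : 'I_k)
    (a : R) : copula C -> 0 <= a <= 1 ->
  C (\row_l (if l == j then a else 1)) = a.
Proof.
move=> [mu [mu_unif CE]] a01; apply: EFin_inj; rewrite CE; last first.
  by move=> l; rewrite mxE; case: ifPn => // _; rewrite ler01 lexx.
have mle l c : measurable [set y : k.-tuple (measurableTypeR R) | tnth y l <= c].
  rewrite (_ : [set _ | _] = (@tnth _ _)^~ l @^-1` `]-oo, c]%classic); last first.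
    by apply/seteqP; split => y /=; rewrite in_itv.
  by rewrite -[X in measurable X]setTI; apply: (measurable_tnth l) => //; exact: measurable_itv.
have mu_le l c : 0 <= c <= 1 -> mu [set y | tnth y l <= c] = c%:E.
  move=> c01; rewrite -(uniform_prob01_le c01) -(mu_unif l).
    by congr (mu _); apply/seteqP; split => y /=; rewrite in_itv.
  exact: measurable_itv.
have le1 : {ae mu, forall y, forall l : 'I_k, tnth y l <= 1}.
  apply: filter_forall => l; exists (~` [set y | tnth y l <= 1]); split => //.
    exact: measurableC.
  by rewrite probability_setC// mu_le ?ler01 ?lexx// subee.
rewrite -(mu_le j _ a01).
set A := [set y | forall l, _].
have mA : measurable A.
  rewrite (_ : A = \bigcap_(l in [set: 'I_k])
      [set y | tnth y l <= (\row_l (if l == j then a else 1) : 'rV_k) 0 l]).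
    by apply: fin_bigcap_measurable => [|l _]; [exact: finite_finset|exact: mle].
  by apply/seteqP; split => y /= yA l; [move=> _; exact: yA|exact: yA].
apply/eqP; rewrite eq_le; apply/andP; split.
  rewrite le_measure ?inE// => y /(_ j) /=; by rewrite mxE eqxx.
have [N [mN N0 le1N]] := le1.
apply: (@le_trans _ _ (mu (A `|` N))).
  rewrite le_measure ?inE//; first exact: measurableU.
  move=> y /= yj; apply: contrapT => yAN.
  apply: (yAN); right; apply: le1N => y1; apply: (yAN); left => l.
  by rewrite mxE; case: eqVneq => [->//|_]; exact: y1.
apply: (@le_trans _ _ (mu A + mu N)%E); first exact: measureU2.
by rewrite N0 adde0.
Qed.

(** * Order statistics as random variables *)

Section order_statistic_lemmas.
Context (R : realType) (d : measure_display) (Omega : measurableType d) (k : nat).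
Variables (tau : 'I_k -> Omega -> \bar R) (i : 'I_k).

Lemma order_statistic_mem w : exists j, order_statistic tau i w = tau j w.
Proof.
set s := [seq tau j w | j <- enum 'I_k].
have /mapP[j _ ->] : order_statistic tau i w \in s.
  rewrite -(mem_sort <=%O) mem_nth// size_sort size_map size_enum_ord.
  exact: ltn_ord.
by exists j.
Qed.

Lemma measurable_order_statistic : (forall j, measurable_fun setT (tau j)) ->
  measurable_fun setT (order_statistic tau i).
Proof.
move=> mtau.
apply: (measurability _ (ErealGenOInfty.measurableE R)) => _ /= -[_ [r ->] <-].
rewrite setTI (_ : _ @^-1` _ = ~` [set w | (order_statistic tau i w <= r%:E)%E]).
  apply: measurableC; rewrite order_statistic_le.
  apply: fin_bigcup_measurable => [|I _]; first exact: finite_finset.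
  rewrite (_ : [set _ | _] = \bigcap_(j in [set` I]) [set w | (tau j w <= r%:E)%E]).
    apply: fin_bigcap_measurable => [|j _]; first exact: finite_finset.
    by rewrite -(setTI [set _ | _]); exact: emeasurable_fun_infty_c.
  by apply/seteqP; split => w /= H j jI; apply: H.
apply/seteqP; split => w /=; rewrite in_itv/= andbT ltNge => /negP //.
Qed.

End order_statistic_lemmas.

(** * From rational times to real times by right-continuity *)

Lemma right_limit_integral (R : realType) (mu : {measure set (\bar R) -> \bar R})
    (p : \bar R -> R) (f : \bar R -> R) (r : R) (t : \bar R) :
  measurable_fun setT p -> (forall v, 0 <= p v) -> 0 <= r -> (r%:E < t)%E ->
  f v%:E @[v --> r^'+] --> f r%:E ->
  (forall q : rat, 0 <= ratr q :> R -> ((ratr q : R)%:E <= t)%E ->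
    ((f (ratr q)%:E)%:E = \int[mu]_(v in `[0%E, (ratr q)%:E]) (p v)%:E)%E) ->
  ((f r%:E)%:E = \int[mu]_(v in `[0%E, r%:E]) (p v)%:E)%E.
Proof.
move=> mp p0 r0 rt fr fE.
have [c rc ct] : exists2 c : R, r < c & (c%:E <= t)%E.
  case: t rt {fE} => [s|_|//]; first by rewrite lte_fin => rs; exists s.
  by exists (r + 1); rewrite ?ltrDl// leey.
(* At the rational [q0] the hypothesis shows that the mass of [0, q0] is finite. The points [s n]
   decrease to [r] without exceeding [q0], so continuity from above applies along them. *)
have [q0] := rat_in_itvoo rc; rewrite in_itv/= => /andP[rq0 q0c].
pose e := ratr q0 - r; have e0 : 0 < e by rewrite subr_gt0.
pose s n := r + e / n.+1%:R.
have rs n : r < s n by rewrite ltrDl divr_gt0.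
have s_le n : s n <= ratr q0.
  by rewrite /s addrC -lerBrDr -/e ler_pdivrMr// ler_peMr ?ler1n// ltW.
have s_cvg : s n @[n --> \oo] --> r.
  rewrite -[X in _ --> X]addr0; apply: cvgD; first exact: cvg_cst.
  by rewrite -[X in _ --> X](mulr0 e); apply: cvgMl_tmp; exact: cvg_harmonic.
(* These rationals need not decrease; squeezing them between [r] and [s n] suffices for both
   limits. *)
have /choice[q qP] n : exists x : rat, r < ratr x < s n.
  by have [x] := rat_in_itvoo (rs n); rewrite in_itv/= => ?; exists x.
pose nu := density mu mp p0.
have qn_le n : ((ratr (q n) : R)%:E <= t)%E.
  rewrite (le_trans _ ct)// lee_fin ltW// (lt_le_trans _ (ltW q0c))//.
  by case/andP: (qP n) => _ /lt_le_trans; exact.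
have U_cvg : nu `[0%E, (s n)%:E]%classic @[n --> \oo] --> nu `[0%E, r%:E]%classic.
  rewrite (_ : `[0%E, r%:E]%classic = \bigcap_n `[0%E, (s n)%:E]%classic).
    apply: nonincreasing_cvg_mu.
    - apply: (@le_lt_trans _ _ (nu `[0%E, (ratr q0)%:E]%classic)).
        rewrite le_measure ?inE//; try exact: emeasurable_itv.
        move=> v /=; rewrite !in_itv/= => /andP[-> /le_trans]; apply.
        by rewrite lee_fin.
      rewrite /nu/= /density -fE ?ltry// ?lee_fin.
        by rewrite (le_trans r0)// ltW.
      by rewrite (le_trans _ ct)// lee_fin ltW.
    - by move=> n; exact: emeasurable_itv.
    - by apply: bigcapT_measurable => n; exact: emeasurable_itv.
    - move=> n m nm; apply/subsetPset => v /=; rewrite !in_itv/= => /andP[-> /le_trans].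
      apply; rewrite lee_fin lerD2l ler_pM2l// lef_pV2 ?posrE//.
      by rewrite ler_nat.
  apply/seteqP; split => v /=.
    rewrite in_itv/= => /andP[v0 vr] n _ /=; rewrite in_itv/= v0 (le_trans vr)//.
    by rewrite lee_fin ltW.
  move=> vs; have /= := vs 0%N I; rewrite !in_itv/= => /andP[v0 vs0].
  rewrite v0/=; case: v v0 vs0 vs => [v| |]// v0 vs0 vs; rewrite lee_fin.
  rewrite -(cvg_lim (@Rhausdorff R) s_cvg).
  apply: limr_ge; first exact: cvgP s_cvg.
  near=> n.
  by have /= := vs n I; rewrite in_itv/= lee_fin => /andP[].
have fqE n : (f (ratr (q n))%:E)%:E = nu `[0%E, (ratr (q n))%:E]%classic.
  by rewrite fE//; rewrite (le_trans r0)// ltW//; case/andP: (qP n).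
have nu_le (a b : R) : a <= b -> (nu `[0%E, a%:E]%classic <= nu `[0%E, b%:E]%classic)%E.
  move=> ab; apply: le_measure; rewrite ?inE; try exact: emeasurable_itv.
  by move=> v /=; rewrite !in_itv/= => /andP[-> /le_trans]; apply; rewrite lee_fin.
have q_cvg : (f (ratr (q n))%:E)%:E @[n --> \oo] --> nu `[0%E, r%:E]%classic.
  apply: (squeeze_cvge _ (cvg_cst _) U_cvg); near=> n.
  by have /andP[rq qs] := qP n; rewrite fqE /= !nu_le// ltW.
have fq_cvg : f (ratr (q n))%:E @[n --> \oo] --> f r%:E.
  move/cvg_at_rightP : fr; apply; split; first by move=> n; case/andP: (qP n).
  apply: (squeeze_cvgr _ (cvg_cst _) s_cvg); near=> n.
  by case/andP: (qP n) => /ltW -> /ltW ->.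
apply: cvg_unique q_cvg.
  exact: ereal_hausdorff.
by apply: cvg_EFin => //; near=> n.
Unshelve. all: end_near.
Qed.

(** * Domination of a law and differentiability at a fixed time *)

Section sub_sigma_algebra.
Context (R : realType) (d : measure_display) (Omega : measurableType d).
Implicit Types G : set (set Omega).

Lemma measurable_wrtS G1 G2 (X : Omega -> R) : G1 `<=` G2 ->
  measurable_wrt G1 X -> measurable_wrt G2 X.
Proof.
move=> G12 mX _ U mU; have := mX measurableT U mU.
by apply: sub_smallest2r => //; exact: smallest_sigma_algebra.
Qed.

Lemma measurable_id_sub G : G `<=` measurable ->
  measurable_fun setT (id : Omega -> g_sigma_algebraType G).
Proof.
move=> Gm _ U mU; rewrite setTI.
by apply: smallest_sub mU => //; exact: sigma_algebra_measurable.
Qed.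

End sub_sigma_algebra.

Section horizon.
Context (R : realType) (d : measure_display) (Omega : measurableType d).
Variables (Q : probability Omega R) (F : \bar R -> set (set Omega)).
Variable A : increasing_process R Omega.
Hypotheses (hF : filtration Q F) (hA : ip_adapted F A).

(** Absolute continuity, for times in [0, t], of the law of (w, sigma w) with respect to Q(dw)
    dA_v(w). It is phrased through null sections, so that no product measure has to be formed. *)
Definition law_dominated (t : \bar R) (sigma : Omega -> \bar R) :=
  forall B : set (g_sigma_algebraType (F t) * \bar R), measurable B ->
    {ae Q, forall w, ip_measure A w (xsection B w `&` `[0%E, t]) = 0%E} ->
    Q [set w | B (w, sigma w) /\ (0 <= sigma w <= t)%E] = 0%E.

Variable t : \bar R.
Hypothesis t0 : (0 <= t)%E.

Local Notation X := (g_sigma_algebraType (F t)).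

Let mF (W : set Omega) : F t W <-> measurable (W : set X).
Proof.
by rewrite measurable_g_measurableTypeE//; exact: filtration_sigma hF _ t0.
Qed.

Let FO (W : set Omega) : F t W -> measurable W.
Proof. exact: filtration_sub hF _ t0 W. Qed.

Let mid : measurable_fun setT (id : Omega -> X).
Proof. by apply: measurable_id_sub => W; exact: FO. Qed.

Let mpath (s : R) : (s%:E <= t)%E -> measurable_wrt (F t) (fun w => ip_path A w s).
Proof.
move=> st; have [s0|s0] := ltP s 0.
  rewrite (_ : (fun w => _) = cst 0); first exact: measurable_cst.
  by apply/funext => w; rewrite ip_path_lt0.
apply: (measurable_wrtS (filtration_mono hF _ st)); first by rewrite lee_fin.
exact: hA.1.
Qed.

Let mjump : t = +oo%E -> measurable_wrt (F t) (fun w => (ip_jump A w)%:num).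
Proof. by move=> ->; exact: hA.2. Qed.

Let m : X -> {measure set (\bar R) -> \bar R} := @stopped_measure R d Omega A (F t) t.

Let m_fin n w : (m w (@finite_horizon R n) < +oo)%E.
Proof. exact: stopped_measure_fin. Qed.

Let mm n U : measurable U ->
  measurable_fun setT (fun w => m w (U `&` @finite_horizon R n)).
Proof. exact: measurable_stopped_measure. Qed.

Let mSt : measurable (`[0%E, t]%classic : set (\bar R)).
Proof. exact: emeasurable_itv. Qed.

Let mE w U : measurable U -> m w U = ip_measure A w (U `&` `[0%E, t]).
Proof. by move=> mU; rewrite /m /stopped_measure restrictedE. Qed.

Let integral_m w U (p : X * \bar R -> R) : measurable U ->
  measurable_fun setT p -> (forall z, 0 <= p z) ->
  (\int[m w]_(v in U) (p (w, v))%:E =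
   \int[ip_measure A w]_(v in U `&` `[0, t]) (p (w, v))%:E)%E.
Proof.
move=> mU mp p0; rewrite /m /stopped_measure integral_restricted//.
  by apply/measurable_EFinP; exact: measurableT_comp.
by move=> v; rewrite lee_fin.
Qed.

Let measurable_integral_m U (p : X * \bar R -> R) : measurable U ->
  measurable_fun setT p -> (forall z, 0 <= p z) ->
  measurable_fun setT (fun w : X => \int[m w]_(v in U) (p (w, v))%:E)%E.
Proof.
move=> mU mp p0; apply: (measurable_integral_section _ _ m_fin mm) => //.
- exact: measurable_finite_horizon.
- exact: bigcup_finite_horizon.
Qed.

(** Integrating the differentiability identity over sets of F_t shows that the law of (w, sigma w)
    has density p, and a law with a density charges no null set. *)
Lemma law_dominated_differentiable (M : \bar R -> \bar R -> Omega -> R)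
    (sigma : Omega -> \bar R) :
  random_time sigma -> differentiable_iM Q F A M t ->
  (forall u, (0 <= u)%E -> (u <= t)%E -> measurable_wrt (F t) (M u t)) ->
  (forall u w, (0 <= u)%E -> (u <= t)%E -> 0 <= M u t w <= 1) ->
  (forall u W, (0 <= u)%E -> (u <= t)%E -> F t W ->
    \int[Q]_(w in W) (M u t w)%:E = Q (W `&` [set w | (sigma w <= u)%E]))%E ->
  law_dominated t sigma.
Proof.
move=> [msigma sigma0] [p [mp p0 pE]] mM M01 ME B mB nullB.
apply: (marked_law_null mid msigma mSt (@measurable_finite_horizon R)
  (@bigcup_finite_horizon R) m_fin mm mp p0 _ mB); last first.
  apply: filterS nullB => w; rewrite mE//; exact: measurable_xsection.
move=> W u mW; have FW : F t W by exact/mF.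
have mle : measurable [set v : \bar R | (v <= u)%E].
  by rewrite -(setTI [set _ | _]); exact: emeasurable_fun_infty_c.
rewrite preimage_id; under eq_integral do rewrite integral_m//.
(* For negative [u] both sides vanish, as neither [sigma] nor [0, t] goes below 0. *)
have [u0|u0] := ltP u 0%E.
  rewrite integral0_eq; last first.
    move=> w _; rewrite (_ : _ `&` _ = set0) ?integral_set0//.
    apply/seteqP; split => v //= [vu]; rewrite in_itv/= => /andP[v0 _].
    by have := le_lt_trans v0 (le_lt_trans vu u0); rewrite ltxx.
  rewrite (_ : [set _ | _] = set0) ?measure0//.
  apply/seteqP; split => w //= [_ su _].
  by have := le_lt_trans (sigma0 w) (le_lt_trans su u0); rewrite ltxx.
(* The law already requires [sigma] to be at most [t], so [u] may be truncated to the range where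
   the density formula is given. *)
pose u' := Order.min u t.
have u'0 : (0 <= u')%E by rewrite le_min u0.
have u't : (u' <= t)%E by rewrite ge_min lexx orbT.
transitivity (Q (W `&` [set w | (sigma w <= u')%E])).
  congr (Q _); apply/seteqP; split => w /=; rewrite in_itv/= le_min.
    by move=> [Ww -> /andP[_ ->]].
  by move=> [Ww /andP[-> ->]]; rewrite sigma0.
have -> : [set v | (v <= u)%E] `&` `[0%E, t] = `[0%E, u']%classic.
  apply/seteqP; split => v /=; rewrite !in_itv/= le_min.
    by move=> [-> /andP[-> ->]].
  by move=> /andP[-> /andP[-> ->]].
rewrite -ME//; apply: ge0_ae_eq_integral.
- exact: FO.
- apply/measurable_funTS/measurable_EFinP.
  exact: (measurableT_comp (mM _ u'0 u't) mid).
- apply: measurable_funTS.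
  have := measurableT_comp (measurable_integral_m (emeasurable_itv `[0%E, u']) mp p0) mid.
  apply: eq_measurable_fun => w _ /=; rewrite integral_m ?(setIidl _)//; last first.
    exact: emeasurable_itv.
  by move=> v /=; rewrite !in_itv/= => /andP[-> /le_trans]; apply.
- by move=> w _; rewrite lee_fin; case/andP: (M01 u' w u'0 u't).
- by move=> w _; apply: integral_ge0 => v _; rewrite lee_fin.
- by apply: filterS pE => w /(_ u' u'0 u't) /= ->.
Qed.

(** The restriction of [Q] to F_t. On this space, equal integrals over the sets of F_t are equal
    integrals over all measurable sets, which forces almost sure equality. *)
Let QF : {measure set X -> \bar R}.
Proof. by refine (pushforward Q (id : Omega -> X)); exact: mid. Defined.

Lemma differentiable_law_dominated (N : \bar R -> \bar R -> Omega -> R)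
    (sigma : Omega -> \bar R) :
  random_time sigma -> associated_iM_family Q F sigma N ->
  law_dominated t sigma -> differentiable_iM Q F A N t.
Proof.
move=> [msigma sigma0] [iMN NE] dom.
have [|p [mp p0 pE]] := @marked_law_density _ _ _ _ _ Q _ sigma _ mid msigma mSt m _
  (@measurable_finite_horizon R) (@bigcup_finite_horizon R) m_fin mm.
  move=> B mB nullB; apply: dom => //.
  by apply: filterS nullB => w; rewrite mE//; exact: measurable_xsection.
exists p; split => //.
have aeE u : (0 <= u)%E -> (u <= t)%E -> {ae Q, forall w,
    ((N u t w)%:E = \int[ip_measure A w]_(v in `[0%E, u]) (p (w, v))%:E)%E}.
  move=> u0 ut.
  have [mN intN NcE] := NE u t u0 ut.
  have mu : measurable (`[0%E, u]%classic : set (\bar R)) by exact: emeasurable_itv.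
  have itv_t : `[0%E, u] `&` `[0%E, t] = `[0%E, u]%classic.
    by rewrite setIidl// => v /=; rewrite !in_itv/= => /andP[-> /le_trans]; apply.
  pose I (w : X) := (\int[ip_measure A w]_(v in `[0%E, u]) (p (w, v))%:E)%E.
  have mI : measurable_fun setT I.
    apply: eq_measurable_fun (measurable_integral_m mu mp p0) => w _.
    by rewrite integral_m// itv_t.
  have I0 w : (0 <= I w)%E by apply: integral_ge0 => v _; rewrite lee_fin.
  have mNX : measurable_fun setT (EFin \o N u t : X -> \bar R) by exact/measurable_EFinP.
  have N0 w : (0 <= (N u t w)%:E)%E.
    by rewrite lee_fin; case/andP: (iM_itv01 iMN w u0 ut).
  have intQF : QF.-integrable setT (EFin \o N u t).
    apply/integrableP; split => //.
    rewrite ge0_integral_pushforward//; last exact: measurableT_comp.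
    by case/integrableP: intN.
  have [B [mB QB0 NIB]] : {ae QF, forall w, setT w -> (N u t w)%:E = I w}.
    apply: integral_ae_eq => // W _ mW; have FW : F t W by exact/mF.
    rewrite !ge0_integral_pushforward//; try exact: measurable_funTS.
    rewrite preimage_id [LHS]NcE// integral_indic; last 2 first.
    - exact: FO.
    - by rewrite -(setTI [set _ | _]); exact: emeasurable_fun_infty_c.
    transitivity (Q [set w | [/\ W w, `[0%E, u]%classic (sigma w) & `[0%E, t]%classic (sigma w)]]).
      congr (Q _); apply/seteqP; split => w /=; rewrite !in_itv/= sigma0/=.
        by move=> [su Ww]; rewrite su (le_trans su ut).
      by move=> [].
    rewrite pE// preimage_id; apply: eq_integral => w _.
    by rewrite integral_m// itv_t.
  exists B; split => //; first exact/FO/mF.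
  by move=> w /= NI; apply: NIB => /= /(_ Logic.I).
have aeQ : {ae Q, forall w, forall q : rat, 0 <= ratr q :> R ->
    ((ratr q : R)%:E <= t)%E -> ((N (ratr q)%:E t w)%:E =
      \int[ip_measure A w]_(v in `[0%E, (ratr q)%:E]) (p (w, v))%:E)%E}.
  (* The rationals are enumerated by their codes, so that countably many null sets are merged; an
     integer coding no rational carries a trivial statement. *)
  pose E n w := if unpickle n is Some q then 0 <= ratr q :> R ->
    ((ratr q : R)%:E <= t)%E -> ((N (ratr q)%:E t w)%:E =
      \int[ip_measure A w]_(v in `[0%E, (ratr q)%:E]) (p (w, v))%:E)%E else True.
  have : {ae Q, forall w, forall n, E n w}.
    apply: ae_foralln => n; rewrite /E; case: (unpickle n) => [q|]; last exact: aeW.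
    have [q0|q0] := pselect (0 <= ratr q :> R); last first.
      by apply: aeW => w ?; exfalso; exact: q0.
    have [qt|qt] := pselect ((ratr q : R)%:E <= t)%E; last first.
      by apply: aeW => w _ ?; exfalso; exact: qt.
    by apply: filterS (aeE (ratr q)%:E _ qt) => //; rewrite lee_fin.
  by apply: filterS => w Ew q; have := Ew (pickle q); rewrite /E pickleK.
(* The end point [u = t] is taken separately, since right-continuity in [u] is given only for
   [u < t]. *)
apply: filterS2 (aeE t t0 (lexx t)) aeQ => w Et Eq u u0 ut.
have [->//|u_neq_t] := eqVneq u t.
have ut' : (u < t)%E by rewrite lt_neqAle u_neq_t.
case: u u0 ut u_neq_t ut' => [r| |]//; last by move=> _ _ _; rewrite ltNge leey.
rewrite lee_fin => r0 rt _ rt'.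
apply: (right_limit_integral (p := fun v => p (w, v)) (f := fun v => N v t w)
  _ _ r0 rt').
- by apply: (@measurableT_comp _ _ _ _ _ _ p).
- by move=> v.
- exact: iM_right_continuous iMN _ _ _ r0 rt'.
- exact: Eq.
Qed.

End horizon.

(** * Transfer of domination to earlier times and to order statistics *)

Section domination.
Context (R : realType) (d : measure_display) (Omega : measurableType d).
Variables (Q : probability Omega R) (F : \bar R -> set (set Omega)).
Variable A : increasing_process R Omega.
Hypothesis hF : filtration Q F.

(** A set measurable for F_s is measurable for F_t, and cutting it down to times in [0, s] turns the
    claim at [s] into an instance of the one at [t]. *)
Lemma law_dominatedW (s t : \bar R) sigma : (0 <= s)%E -> (s <= t)%E ->
  law_dominated Q F A t sigma -> law_dominated Q F A s sigma.
Proof.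
move=> s0 st dom B mB nullB.
have itv_s : `[0%E, s] `&` `[0%E, t] = `[0%E, s]%classic.
  by rewrite setIidl// => v /=; rewrite !in_itv/= => /andP[-> /le_trans]; apply.
pose B' : set (g_sigma_algebraType (F t) * \bar R) :=
  B `&` (setT `*` `[0%E, s]%classic).
have mB' : measurable B'.
  apply: measurableI; last by apply: measurableX => //; exact: emeasurable_itv.
  have mid : measurable_fun setT
      (id : g_sigma_algebraType (F t) -> g_sigma_algebraType (F s)).
    move=> _ U mU; rewrite setTI; move: mU; apply: sub_smallest2r.
      exact: smallest_sigma_algebra.
    exact: filtration_mono hF _ _ s0 st.
  have mpair := measurable_fun_pair
    (measurableT_comp mid measurable_fst) (@measurable_snd _ _ _ (\bar R)).
  have := mpair measurableT B mB; rewrite setTI.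
  by congr measurable; apply/seteqP; split => -[].
have := dom B' mB'; rewrite (_ : [set w | B' (w, sigma w) /\ _] =
    [set w | B (w, sigma w) /\ (0 <= sigma w <= s)%E]); last first.
  apply/seteqP; split => w /=; first by move=> [[? [_ /=]]]; rewrite in_itv.
  move=> [? /andP[s0' s1]]; split; last by rewrite s0' (le_trans s1).
  by split => //; split => //=; rewrite in_itv/= s0' s1.
apply; apply: filterS nullB => w nullBw; rewrite -[RHS]nullBw; congr (ip_measure A w _).
rewrite /B' xsectionI -setIA; congr (_ `&` _).
by rewrite in_xsectionX ?in_setT.
Qed.

(** On each path the order statistic equals some [tau j], so the event lies in a finite union of
    null events. *)
Lemma law_dominated_order_statistic k (tau : 'I_k -> Omega -> \bar R) i t :
  (0 <= t)%E -> (forall j, measurable_fun setT (tau j)) ->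
  (forall j, law_dominated Q F A t (tau j)) ->
  law_dominated Q F A t (order_statistic tau i).
Proof.
move=> t0 mtau dom B mB nullB.
have mid : measurable_fun setT (id : Omega -> g_sigma_algebraType (F t)).
  by apply: measurable_id_sub; exact: filtration_sub hF _ t0.
have mE (sigma : Omega -> \bar R) : measurable_fun setT sigma ->
    measurable [set w | B (w, sigma w) /\ (0 <= sigma w <= t)%E].
  move=> ms; rewrite (_ : [set _ | _] =
      (fun w => ((w : g_sigma_algebraType (F t)), sigma w)) @^-1` B `&`
      sigma @^-1` `[0%E, t]).
    apply: measurableI; rewrite -[X in measurable X]setTI.
      by apply: (measurable_fun_pair mid ms).
    by apply: ms => //; exact: emeasurable_itv.
  by apply/seteqP; split => w /=; rewrite in_itv.
apply: measure_negligible; first exact/mE/measurable_order_statistic.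
have : {ae Q, forall w, forall j, ~ (B (w, tau j w) /\ (0 <= tau j w <= t)%E)}.
  apply: filter_forall => j.
  exists [set w | B (w, tau j w) /\ (0 <= tau j w <= t)%E]; split.
  - exact: mE.
  - exact: dom.
  - by move=> w /= /contrapT.
move=> [W [mW W0 sub]]; exists W; split => // w /= Bw; apply: sub => /= H.
by have [j jE] := order_statistic_mem tau i w; apply: (H j); rewrite -jE.
Qed.

Lemma conditional_copula_marginal k C (M : 'I_k -> \bar R -> \bar R -> Omega -> R)
    (tau : 'I_k -> Omega -> \bar R) T j u :
  copula C -> (forall l, iM_family Q F (M l)) -> (0 <= T)%E ->
  conditional_copula_law Q F C M tau T -> (0 <= u)%E -> (u <= T)%E ->
  is_condprob Q (F T) [set w | (tau j w <= u)%E] (M j u T).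
Proof.
move=> copC iM T0 condC u0 uT; pose v l : \bar R := if l == j then u else +oo%E.
have vP l : (0 <= v l)%E /\ ((v l <= T)%E \/ v l = +oo%E).
  by rewrite /v; case: ifPn => _; split; [|left| |right].
have [mC intC CE] := condC v vP.
have [mM intM _] := iM_martingale (iM j) u0.
have FT0 : F T `<=` measurable by exact: filtration_sub hF _ T0.
have MC : {ae Q, forall w,
    C (\row_l (if (v l <= T)%E then M l (v l) T w else 1)) = M j u T w}.
  (* If [T] is +oo, the unconstrained coordinates are evaluated as [M l +oo +oo], which is 1 only
     almost surely; for finite [T] they are 1 by the conditional itself. *)
  have Moo : {ae Q, forall w, forall l, M l +oo%E +oo%E w = 1}.
    by apply: filter_forall => l; exact: iM_infty (iM l).
  apply: filterS Moo => w Mw; rewrite -[RHS](copula_marginal j copC (iM_itv01 (iM j) w u0 uT)).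
  congr C; apply/rowP => l; rewrite !mxE /v; case: eqVneq => [->|_]; first by rewrite uT.
  by case: ifPn => //; rewrite leye_eq => /eqP ->.
split; [exact: mM|exact: intM|] => W FW.
rewrite (_ : [set w | (tau j w <= u)%E] = [set w | forall l, (tau l w <= v l)%E]).
  rewrite -CE//; apply: ae_eq_integral.
  - exact: FT0.
  - by apply: measurable_funTS; have /integrableP[] := intM T uT.
  - by apply: measurable_funTS; have /integrableP[] := intC.
  - by apply: filterS MC => w /= ->.
apply/seteqP; split => w /=; last by move=> /(_ j); rewrite /v eqxx.
by move=> wu l; rewrite /v; case: eqVneq => [->//|_]; rewrite leey.
Qed.

End domination.

(** * Differentiability of the order statistics *)

Theorem theorem6p2 (R : realType) (d : measure_display)
    (Omega : measurableType d) (Q : probability Omega R)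
    (F : \bar R -> set (set Omega)) (k : nat)
    (C : 'rV[R]_k -> R)
    (Z : 'I_k -> R -> Omega -> R)
    (M : 'I_k -> \bar R -> \bar R -> Omega -> R)
    (A : increasing_process R Omega)
    (T : \bar R)
    (tau : 'I_k -> Omega -> \bar R) :
  filtration Q F ->
  copula C ->
  continuously_differentiable_on_cube C ->
  (forall j, azema_supermartingale Q F (Z j)) ->
  (forall j, iM_Z_family Q F (Z j) (M j)) ->
  ip_adapted F A ->
  (0 <= T)%E ->
  (forall j, differentiable_iM Q F A (M j) T) ->
  (forall j, random_time (tau j)) ->
  conditional_copula_law Q F C M tau T ->
  forall (i : 'I_k) (N : \bar R -> \bar R -> Omega -> R),
    associated_iM_family Q F (order_statistic tau i) N ->
    forall t, (0 <= t)%E -> (t <= T)%E -> differentiable_iM Q F A N t.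
Proof.
move=> hF copC _ _ hM hA T0 diffM rtau condC i N assN t t0 tT.
have iM j : iM_family Q F (M j) by exact: iM_Z_iM (hM j).
have mtau j : measurable_fun setT (tau j) by have [] := rtau j.
(* By the marginal conditional law, [M j u T] integrates over a set W of F_T to the probability of W
   together with [tau j] being at most [u]. *)
have domT j : law_dominated Q F A T (tau j).
  apply: (law_dominated_differentiable hF hA T0 (rtau j) (diffM j)).
  - by move=> u u0 uT; have [mM _ _] := iM_martingale (iM j) u0; exact: mM.
  - by move=> u w u0 uT; exact: (iM_itv01 (iM j) w u0 uT).
  - move=> u W u0 uT FW.
    have [_ _ ->//] := conditional_copula_marginal hF j copC iM T0 condC u0 uT.
    rewrite integral_indic 1?setIC//; first exact: filtration_sub hF _ T0 W FW.
    by rewrite -(setTI [set _ | _]); exact: emeasurable_fun_infty_c.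
have rsigma : random_time (order_statistic tau i).
  split; first exact: measurable_order_statistic.
  by move=> w; have [j ->] := order_statistic_mem tau i w; have [_] := rtau j.
(* The comparison with the [tau j] is made at [T], where their domination is known, and the result
   is then lowered to [t]. *)
apply: (differentiable_law_dominated hF hA t0 rsigma assN).
apply: (law_dominatedW hF t0 tT).
exact: law_dominated_order_statistic.
Qed.
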